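(* Consider the Basic Independence Model, let $0<\alpha<\lambda<1$, let $\beta_1,\dots,\beta_k$ be fixed positive weights with $\sum_{i=1}^k\beta_i=1$, and let $\hat n_{0,1},\dots,\hat n_{0,k}$ be estimators, each of which is a strictly positive measurable function of $(\hat F_n(t))_{t\ge\lambda}$, such that $$E\left(\frac{V(\lambda)}{\hat n_{0,i}}\right)\le\lambda,\qquad i=1,\dots,k.$$ Then the weighted estimator $$\hat n_0=\sum_{i=1}^k\beta_i\hat n_{0,i}$$ satisfies $E\left(\frac{V(\lambda)}{\hat n_0}\right)\le\lambda$, and the adaptive step up test with critical values $\hat\alpha_{i:n}=\left(\frac{i}{\hat n_0}\alpha\right)\wedge\lambda$, $i=1,\dots,n$, has $FDR\le\alpha$.
   Context: Basic Independence (BI) Model: $n\ge 1$ null hypotheses $\mathcal H_1,\dots,\mathcal H_n$; $(H_i,\xi_i)_{i\le n}$ is an arbitrary random vector with values in $(\{0,1\}\times[0,1])^n$; $U_1,\dots,U_n$ are independent, uniformly distributed on $(0,1)$, and independent of $(H_i,\xi_i)_{i\le n}$. $\mathcal H_i$ is true if $H_i=0$ and false if $H_i=1$. The $p$-values are $p_i=(1-H_i)U_i+H_i\xi_i$. Put $N_0=\sum_{i=1}^n(1-H_i)$ and assume $E(N_0)>0$. Let $\hat F_n(t)=\frac1n\sum_{i=1}^n 1\{p_i\le t\}$, $t\in[0,1]$, and let $p_{1:n}\le\dots\le p_{n:n}$ be the order statistics of the $p$-values. Notation: $a\wedge b=\min(a,b)$, $a\vee b=\max(a,b)$. For $t\in[0,1]$: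 $V(t)=\sum_{i=1}^n 1\{p_i\le t,H_i=0\}$. Adaptive step up (SU) test with data dependent critical values $0=\hat\alpha_{0:n}<\hat\alpha_{1:n}\le\dots\le\hat\alpha_{n:n}<1$: with $R=\max\{i: p_{i:n}\le\hat\alpha_{i:n}\}$ ($\max\emptyset=0$), it rejects all null hypotheses whose $p$-value is $\le\hat\alpha_{R:n}$; $R$ is the number of rejections. With $V=\sum_{i=1}^n 1\{p_i\le\hat\alpha_{R:n},H_i=0\}$, $FDR=E\left(\frac{V}{R\vee 1}\right)$. *)

(* Defs.v *)
From HB Require Import structures.
From mathcomp Require Export all_boot all_order all_algebra.
From mathcomp Require Export all_classical all_reals all_analysis.

Set Implicit Arguments.
Unset Strict Implicit.
Unset Printing Implicit Defensive.
Import Order.TTheory GRing.Theory Num.Theory.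
Import numFieldNormedType.Exports.

Local Open Scope classical_set_scope.
Local Open Scope ring_scope.

Section independence.
Context (d : measure_display) (T : measurableType d) (R : realType).
Variable P : probability T R.

Definition mutually_independent (d' : measure_display) (T' : measurableType d')
    (n : nat) (X : 'I_n -> {RV P >-> T'}) : Prop :=
  forall (J : {set 'I_n}) (B : 'I_n -> set T'),
    (forall i, measurable (B i)) ->
    (P (\bigcap_(i in [set` J]) (X i @^-1` B i)) =
     \prod_(i in J) P (X i @^-1` B i))%E.

Definition independent_set_systems (F G : set_system T) : Prop :=
  forall A B, F A -> G B -> (P (A `&` B) = P A * P B)%E.

End independence.

Section basic_independence.
Context (d : measure_display) (T : measurableType d) (R : realType).
Variable P : probability T R.

(* The hypothesis with index i is true iff H i = false. *)
Record basic_independence (n : nat) (H : 'I_n -> {RV P >-> bool})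
    (xi U : 'I_n -> {RV P >-> R}) : Prop := BasicIndependence {
  xi_unit_interval : forall i w, 0 <= xi i w <= 1;
  U_uniform : forall i (B : set R), measurable B ->
    distribution P (U i) B = uniform_prob (@ltr01 R) B;
  U_independent : mutually_independent U;
  U_independent_Hxi :
    independent_set_systems P
      (g_sigma_preimage (fun i w => U i w))
      (g_sigma_preimage (fun i w => (H i w, xi i w)));
  EN0_gt0 : (0 < 'E_P[fun w => (\sum_(i < n) ~~ H i w)%N%:R%R])%E
}.

Definition pvalue (n : nat) (H : 'I_n -> {RV P >-> bool})
    (xi U : 'I_n -> {RV P >-> R}) (w : T) (i : 'I_n) : R :=
  (1 - (H i w)%:R) * U i w + (H i w)%:R * xi i w.

End basic_independence.

Section step_up.
Context (R : realType) (n : nat).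
Implicit Types (h : 'I_n -> bool) (p : 'I_n -> R) (c : nat -> R).

Definition ecdf p (t : R) : R := (\sum_(i < n) (p i <= t)%R)%N%:R / n%:R.

(* p_{i:n}, meaningful for 1 <= i <= n *)
Definition order_stat p (i : nat) : R :=
  nth 0 (sort <=%R [seq p j | j <- enum 'I_n]) i.-1.

Definition true_null_count h p (t : R) : nat :=
  (\sum_(i < n) ((p i <= t)%R && ~~ h i))%N.

(* Critical values are indexed by 0, ..., n, and c 0 is required to be 0:
   it is the rejection threshold when no index i satisfies the condition. *)
Definition su_rejections p c : nat :=
  (\max_(1 <= i < n.+1 | (order_stat p i <= c i)%R) i)%N.

Definition su_false_rejections h p c : nat :=
  true_null_count h p (c (su_rejections p c)).

End step_up.

Definition FDR (R : realType) (d : measure_display) (T : measurableType d)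
    (P : probability T R) (n : nat) (h : T -> 'I_n -> bool)
    (p : T -> 'I_n -> R) (c : T -> nat -> R) : \bar R :=
  ('E_P[fun w => ((su_false_rejections (h w) (p w) (c w))%:R /
                  (maxn (su_rejections (p w) (c w)) 1)%:R)%R])%E.

Section estimators.
Context (R : realType).

(* generators of the product sigma-algebra on R^I *)
Definition cylinders (I : Type) : set_system (I -> R) :=
  \bigcup_(i in [set: I])
    preimage_set_system [set: I -> R] (fun f => f i) measurable.

Definition late_ecdf (n : nat) (lambda : R) (p : 'I_n -> R)
    (t : {t : R | lambda <= t <= 1}) : R := ecdf p (sval t).

(* N is a strictly positive measurable function of (F_n(t))_{lambda <= t <= 1} *)
Definition is_estimator (T : Type) (n : nat) (lambda : R) (p : T -> 'I_n -> R)
    (N : T -> R) : Prop :=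
  (forall w, 0 < N w) /\
  exists g : g_sigma_algebraType (@cylinders {t : R | lambda <= t <= 1}) -> R,
    measurable_fun setT g /\ forall w, N w = g (late_ecdf (p w)).

End estimators.

(* Main.v *)
(* Fix a true null hypothesis i. If p_i is rejected then p_i <= lambda, so
   lowering p_i to 0 changes neither the empirical distribution function on
   [lambda, 1] (hence not n0) nor the number of rejections. After this
   replacement, n0 and the rejection threshold t depend only on (H, xi) and on
   the U_j with j <> i, hence are independent of the uniform variable p_i = U_i.
   Integrating U_i out turns 1{U_i <= t} / R into t / R <= alpha / n0, and
   integrating it back in turns 1 / n0 into 1{U_i <= lambda} / (lambda n0).
   Summing over i gives FDR <= alpha / lambda * E (V(lambda) / n0). The bound
   on E (V(lambda) / n0) for the weighted estimator is the convexity of the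
   inverse. *)
Require Import Defs.
From mathcomp Require Import measurable_realfun.
From mathcomp Require Import ring.

Set Implicit Arguments.
Unset Strict Implicit.
Unset Printing Implicit Defensive.
Import Order.TTheory GRing.Theory Num.Theory.
Import numFieldNormedType.Exports.

Local Open Scope classical_set_scope.
Local Open Scope ring_scope.

(** * Step-up procedures and lowering one p-value *)

Section step_up_combinatorics.
Context (R : realType) (n : nat).
Implicit Types (p : 'I_n -> R) (c : nat -> R).

(** In a sorted sequence the entries that are at most [x] form an initial segment, whose length is
    the count. *)
Lemma nth_sorted_le (s : seq R) m x : sorted <=%R s -> (m < size s)%N ->
  (nth 0 s m <= x) = (m < count (<= x) s)%N.
Proof.
elim: s m => [//|y s IH] m /= ys; have s_sorted := path_sorted ys.
have y_le : all (>= y) s by have := order_path_min le_trans ys.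
have [yx|xy] := leP y x.
  by case: m => [|m] //= ms; rewrite ltnS IH.
have -> : count (<= x) s = 0%N.
  apply/eqP; rewrite -leqn0 leqNgt -has_count; apply/hasPn => z zs /=.
  by rewrite -ltNge (lt_le_trans xy)// (allP y_le).
rewrite addn0 ltn0; case: m => [_|m] /=; first by rewrite leNgt xy.
rewrite ltnS => ms; apply/negbTE; rewrite -ltNge (lt_le_trans xy)//.
by rewrite (allP y_le)// mem_nth.
Qed.

(** This turns the crossing condition of the step-up test into a count of p-values, so that sorting
    plays no part in later arguments. *)
Lemma order_stat_le p m x : (0 < m <= n)%N ->
  (order_stat p m <= x) = (m <= \sum_(j < n) (p j <= x)%R)%N.
Proof.
case: m => [//|m] /= mn; rewrite /order_stat nth_sorted_le/=.
- rewrite count_sort count_map -sum1_count big_enum_cond/= big_mkcond/=.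
  by congr (_ <= _)%N; apply: eq_bigr => j _; case: (p j <= x).
- exact: sort_le_sorted.
- by rewrite size_sort size_map size_enum_ord.
Qed.

Lemma leq_su_rejections p c m :
  (0 < m <= n)%N -> (m <= \sum_(j < n) (p j <= c m)%R)%N ->
  (m <= su_rejections p c)%N.
Proof.
move=> mn hm; rewrite /su_rejections (@leq_bigmax_seq _ _ _ id)//.
- by rewrite mem_index_iota.
- by rewrite order_stat_le.
Qed.

Lemma su_rejections_attained p c (r := su_rejections p c) :
  r = 0%N \/ (0 < r <= n)%N /\ (r <= \sum_(j < n) (p j <= c r)%R)%N.
Proof.
rewrite {}/r /su_rejections big_nat_cond; elim/big_ind: _ => [|x y hx hy|m].
- by left.
- by rewrite /maxn; case: ifP.
- by case/andP => mn; rewrite ltnS in mn; rewrite order_stat_le//; right.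
Qed.

(** The value 0 lies below every nonnegative threshold, so counts at such thresholds no longer
    depend on [p i]. *)
Definition reset_pvalue i p : 'I_n -> R := fun j => if j == i then 0 else p j.

Lemma reset_pvalue_count i p x : 0 <= x -> p i <= x ->
  (\sum_(j < n) (reset_pvalue i p j <= x)%R =
   \sum_(j < n) (p j <= x)%R)%N.
Proof.
move=> x0 pix; apply: eq_bigr => j _; rewrite /reset_pvalue.
by case: eqP => // ->; rewrite x0 pix.
Qed.

Lemma reset_pvalue_count_ge i p x : 0 <= x ->
  (\sum_(j < n) (p j <= x)%R <=
   \sum_(j < n) (reset_pvalue i p j <= x)%R)%N.
Proof.
move=> x0; apply: leq_sum => j _; rewrite /reset_pvalue.
by case: eqP => // _; rewrite x0; case: (_ <= _).
Qed.

(** The p-value that was set to 0 already makes index 1 a crossing. Division by the reset number of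
    rejections is therefore safe without [maxn]. *)
Lemma su_rejections_reset_gt0 i p c : 0 <= c 1%N ->
  (0 < su_rejections (reset_pvalue i p) c)%N.
Proof.
move=> c0; apply: leq_su_rejections.
  by rewrite (leq_ltn_trans _ (ltn_ord i)).
by rewrite (bigD1 i)//= /reset_pvalue eqxx c0.
Qed.

(* Lowering a rejected p-value leaves the largest crossing index unchanged. *)
Lemma su_rejections_reset i p c : {homo c : a b / (a <= b)%N >-> a <= b} ->
  0 <= c 0%N -> p i <= c (su_rejections p c) ->
  su_rejections (reset_pvalue i p) c = su_rejections p c.
Proof.
move=> c_homo c0 pi; have c_ge0 m : 0 <= c m by rewrite (le_trans c0)// c_homo.
have le_reset : (su_rejections p c <= su_rejections (reset_pvalue i p) c)%N.
  have [->//|[rn hr]] := su_rejections_attained p c.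
  by apply: leq_su_rejections => //; rewrite (leq_trans hr)//
    reset_pvalue_count_ge.
apply/eqP; rewrite eqn_leq le_reset andbT.
have [->//|[rn]] := su_rejections_attained (reset_pvalue i p) c.
(* The reset index is at least the original one, so by monotonicity [p i] is below the threshold at
   the reset index too. The counts there agree, and the reset index is a crossing for [p]. *)
rewrite reset_pvalue_count//; last by rewrite (le_trans pi)// c_homo.
exact: leq_su_rejections.
Qed.

(** A p-value may lie below the default threshold [c 0], for instance when both are 0; but then it
    is also below [c 1], and index 1 is a crossing. *)
Lemma su_rejections_gt0 i p c : 0 <= c 0%N -> c 0%N <= c 1%N ->
  p i <= c (su_rejections p c) -> (0 < su_rejections p c)%N.
Proof.
move=> c0 c01; case r0: su_rejections => [|//] pi.
suff: (0 < su_rejections p c)%N by rewrite r0.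
apply: leq_su_rejections; first by rewrite (leq_ltn_trans _ (ltn_ord i)).
by rewrite (bigD1 i)//= (le_trans pi).
Qed.

(** Only arguments [t] with [lambda <= t] are seen, and [i] is counted there before and after the
    reset. *)
Lemma ecdf_reset lambda i p : 0 <= lambda -> p i <= lambda ->
  late_ecdf (lambda := lambda) (reset_pvalue i p) = late_ecdf p.
Proof.
move=> l0 pi; apply/funext => -[t t_itv]; have /andP[lt _] := t_itv.
rewrite /late_ecdf /ecdf/=.
by rewrite reset_pvalue_count// (le_trans _ lt).
Qed.

End step_up_combinatorics.

(** * Measurability of the step-up test and of the estimators *)

Section measurability.
Context (d : measure_display) (T : measurableType d) (R : realType) (n : nat).
Implicit Types (p : T -> 'I_n -> R) (c : T -> nat -> R) (h : T -> 'I_n -> bool).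

Lemma measurable_fun_sumn (I : Type) (s : seq I) (f : I -> T -> nat) :
  (forall i, measurable_fun setT (f i)) ->
  measurable_fun setT (fun w => \sum_(i <- s) f i w)%N.
Proof.
move=> mf; elim: s => [|i s IH].
  by under eq_fun do rewrite big_nil; exact: measurable_cst.
by under eq_fun do rewrite big_cons; exact: measurable_fun_addn.
Qed.

Lemma measurable_fun_natb (b : T -> bool) :
  measurable_fun setT b -> measurable_fun setT (fun w => b w : nat).
Proof. by move=> mb; apply: (measurableT_comp _ mb). Qed.

Lemma measurable_fun_natr (m : T -> nat) :
  measurable_fun setT m -> measurable_fun setT (fun w => (m w)%:R : R).
Proof. by move=> mm; apply: (measurableT_comp _ mm). Qed.

Lemma measurable_fun_inv_gt0 (f : T -> R) : (forall w, 0 < f w) ->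
  measurable_fun setT f -> measurable_fun setT (fun w => (f w)^-1).
Proof.
move=> f0 mf; under eq_fun do rewrite -powR_inv1 ?ltW//.
exact: (measurableT_comp (@measurable_powR R (-1)) mf).
Qed.

Lemma measurable_count p (x : T -> R) :
  (forall j, measurable_fun setT (p ^~ j)) -> measurable_fun setT x ->
  measurable_fun setT (fun w => \sum_(j < n) (p w j <= x w)%R)%N.
Proof.
by move=> mp mx; apply: measurable_fun_sumn => j; apply: measurable_fun_natb;
  exact: measurable_fun_ler.
Qed.

Lemma measurable_true_null_count h p (x : T -> R) :
  (forall j, measurable_fun setT (h ^~ j)) ->
  (forall j, measurable_fun setT (p ^~ j)) -> measurable_fun setT x ->
  measurable_fun setT (fun w => true_null_count (h w) (p w) (x w)).
Proof.
move=> mh mp mx; apply: measurable_fun_sumn => j; apply: measurable_fun_natb.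
by apply: measurable_and; [exact: measurable_fun_ler|exact: measurable_neg].
Qed.

Lemma measurable_su_rejections p c :
  (forall j, measurable_fun setT (p ^~ j)) ->
  (forall m, measurable_fun setT (c ^~ m)) ->
  measurable_fun setT (fun w => su_rejections (p w) (c w)).
Proof.
move=> mp mc.
(* The random condition under the maximum becomes a conditional term with default value 0, and order
   statistics become counts; each term is then visibly measurable. *)
have -> : (fun w => su_rejections (p w) (c w)) = (fun w =>
    \max_(m <- index_iota 1 n.+1)
      if ((0 < m <= n) && (m <= \sum_(j < n) (p w j <= c w m)%R))%N
      then m else 0)%N.
  apply/funext => w; rewrite /su_rejections big_mkcond big_nat_cond.
  rewrite [RHS]big_nat_cond; apply: eq_bigr => m /andP[]; rewrite ltnS => mn _.
  by rewrite order_stat_le// mn.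
elim: (index_iota 1 n.+1) => [|m s IH].
  by under eq_fun do rewrite big_nil; exact: measurable_cst.
under eq_fun do rewrite big_cons.
apply: measurable_fun_maxn => //; apply: measurable_fun_ifT => //.
apply: measurable_and => //; apply: measurable_fun_leq => //.
exact: measurable_count.
Qed.

(* The threshold takes one of countably many values [c w m]. *)
Lemma measurable_su_threshold p c :
  (forall j, measurable_fun setT (p ^~ j)) ->
  (forall m, measurable_fun setT (c ^~ m)) ->
  measurable_fun setT (fun w => c w (su_rejections (p w) (c w))).
Proof.
move=> mp mc; have mR := measurable_su_rejections mp mc.
move=> _ B mB; rewrite setTI.
have -> : (fun w => c w (su_rejections (p w) (c w))) @^-1` B =
    \bigcup_m ((fun w => su_rejections (p w) (c w)) @^-1` [set m] `&`
               (c ^~ m) @^-1` B).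
  apply/seteqP; split=> [w /= Bw|w [m _ [/= <-]]//].
  by exists (su_rejections (p w) (c w)).
apply: bigcup_measurable => m _; apply: measurableI.
- by rewrite -[X in measurable X]setTI; exact: mR.
- by rewrite -[X in measurable X]setTI; exact: mc.
Qed.

Lemma measurable_estimator lambda p
    (g : g_sigma_algebraType (@cylinders R {t : R | lambda <= t <= 1}) -> R) :
  measurable_fun setT g -> (forall j, measurable_fun setT (p ^~ j)) ->
  measurable_fun setT (fun w => g (late_ecdf (p w))).
Proof.
move=> mg mp; pose C := @cylinders R {t : R | lambda <= t <= 1}.
suff mF : measurable_fun setT
    (fun w => late_ecdf (p w) : g_sigma_algebraType C).
  exact: (measurableT_comp mg mF).
(* It suffices to check preimages of the generating cylinders, that is, one evaluation point [t] at
   a time. *)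
apply: (@measurability _ _ T (g_sigma_algebraType C) setT _ C) => //.
move=> _ [_ [t _ [B mB <-]] <-]; rewrite setTI setTI.
have mecdf : measurable_fun setT (fun w => late_ecdf (p w) t).
  apply: measurable_funM => //; apply: measurable_fun_natr.
  exact: measurable_count.
by have := mecdf measurableT B mB; rewrite setTI.
Qed.

End measurability.

(** * Integrating out an independent uniform variable *)

Section independence.
Context (d : measure_display) (T : measurableType d) (R : realType).
Variable P : probability T R.
Local Open Scope ereal_scope.

(** The finite measures sending [B] to [P (A]&[B)] and to [P A * P B] agree on a pi-system
    containing the whole space, hence on the sigma-algebra it generates. *)
Lemma independent_g_sigma_algebra (S : set_system T) (A : set T) :
  measurable A -> S `<=` measurable -> setI_closed S -> S setT ->
  (forall B, S B -> P (A `&` B) = P A * P B) ->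
  forall B, <<s S >> B -> P (A `&` B) = P A * P B.
Proof.
move=> mA mS SI ST SP B SB.
have PA0 : (0 <= fine (P A))%R by rewrite fine_ge0.
pose m1 : {measure set T -> \bar R} := mrestr P mA.
pose m2 : {measure set T -> \bar R} := mscale (NngNum PA0) P.
suff : m1 B = m2 B.
  by rewrite /= /mrestr /mscale/= fineK ?fin_num_measure// setIC.
apply: (g_sigma_algebra_measure_unique S mS (fun=> setT)) => //.
- by rewrite bigcup_const.
- move=> C SC; rewrite /= /mrestr /mscale/= fineK ?fin_num_measure//.
  by rewrite setIC SP.
- by move=> _; rewrite /= /mrestr setTI ltey_eq fin_num_measure.
Qed.

(** Independence identifies the joint law of [(X, Z)] with the product of the marginal laws, by
    uniqueness of the product measure; Tonelli then gives the iterated integral. *)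
Lemma integral_independent (d1 d2 : measure_display) (T1 : measurableType d1)
    (T2 : measurableType d2) (X : {RV P >-> T1}) (Z : {RV P >-> T2})
    (f : T1 * T2 -> \bar R) :
  (forall A B, measurable A -> measurable B ->
    P (X @^-1` A `&` Z @^-1` B) = P (X @^-1` A) * P (Z @^-1` B)) ->
  measurable_fun setT f -> (forall z, 0 <= f z) ->
  \int[P]_w f (X w, Z w) = \int[P]_w \int[distribution P X]_x f (x, Z w).
Proof.
move=> XZ mf f0.
have mW : measurable_fun setT (fun w => (X w, Z w)).
  exact: measurable_fun_pair.
pose W : {RV P >-> (T1 * T2)%type} := mfun_Sub (mem_set mW).
rewrite -(ge0_integral_distribution W mf f0).
rewrite (@eq_measure_integral _ _ _ _ (distribution P X \x distribution P Z)).
  rewrite fubini_tonelli2// (ge0_integral_distribution Z)//.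
  - exact: measurable_fun_fubini_tonelli_G.
  - by move=> z; exact: integral_ge0.
move=> A mA _; apply/esym/product_measure_unique => //; exact: XZ.
Qed.

Lemma uniform_prob_itvNyc (c : R) : (0 <= c <= 1)%R ->
  uniform_prob (@ltr01 R) `]-oo, c] = c%:E.
Proof.
move=> /andP[c0 c1]; rewrite /uniform_prob integral_uniform_pdf.
have -> : `]-oo, c]%classic `&` `[0%R, 1%R]%classic = `[0%R, c]%classic.
  apply/seteqP; split => x /=; rewrite !in_itv/=.
    by move=> [-> /andP[->]].
  by move=> /andP[-> xc]; rewrite xc (le_trans xc).
rewrite (eq_integral (cst 1)); last first.
  move=> x; rewrite inE/= in_itv/= => /andP[x0 xc].
  by rewrite /uniform_pdf x0 (le_trans xc)//= subr0 invr1.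
rewrite integral_cst//= mul1e lebesgue_measure_itv/= lte_fin.
case: ltP => [_|c0']; first by rewrite -EFinD subr0.
by congr EFin; apply/eqP; rewrite eq_le c0 c0'.
Qed.

(** Given the sigma-algebra generated by [S], both [Y] and [c] are frozen while [X] stays uniform,
    so the indicator averages to [c]. *)
Lemma expectation_uniform_le (S : set_system T) (X : {RV P >-> R})
    (Y c : T -> R) :
  (forall B, measurable B -> distribution P X B = uniform_prob (@ltr01 R) B) ->
  <<s S >> `<=` measurable ->
  (forall A B, measurable A -> <<s S >> B ->
    P (X @^-1` A `&` B) = P (X @^-1` A) * P B) ->
  measurable_fun setT (Y : g_sigma_algebraType S -> R) ->
  measurable_fun setT (c : g_sigma_algebraType S -> R) ->
  (forall w, 0 <= Y w)%R -> (forall w, 0 <= c w <= 1)%R ->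
  'E_P[fun w => (Y w * (X w <= c w)%R%:R)%R] = 'E_P[fun w => (Y w * c w)%R].
Proof.
move=> unifX mS XS mY mc Y0 c01.
have mZS : measurable_fun setT
    (fun w : g_sigma_algebraType S => (Y w, c w)).
  exact: measurable_fun_pair.
have mZ : measurable_fun setT (fun w : T => (Y w, c w)).
  by move=> _ B mB; apply: mS; exact: mZS.
pose Z : {RV P >-> (R * R)%type} := mfun_Sub (mem_set mZ).
(* The absolute value makes [f] nonnegative on the whole space; it disappears along [Y], which is
   nonnegative. *)
pose f (z : R * (R * R)) : \bar R := (`|z.2.1| * (z.1 <= z.2.2)%R%:R)%:E.
have mf : measurable_fun setT f.
  apply/measurable_EFinP; apply: measurable_funM.
    by apply: measurableT_comp => //; exact: measurableT_comp.
  apply: measurable_fun_natr; apply: measurable_fun_natb.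
  by apply: measurable_fun_ler => //; exact: measurableT_comp.
have f0 z : 0 <= f z by rewrite lee_fin mulr_ge0.
have XZ A B : measurable A -> measurable B ->
    P (X @^-1` A `&` Z @^-1` B) = P (X @^-1` A) * P (Z @^-1` B).
  move=> mA mB; apply: XS => //.
  by have := mZS measurableT B mB; rewrite setTI.
have := integral_independent XZ mf f0.
rewrite unlock /f /= => fE.
under eq_integral do rewrite -[Y _]ger0_norm//.
rewrite fE; apply: eq_integral => w _.
under eq_integral do rewrite EFinM.
rewrite ge0_integralZl//; last first.
  apply/measurable_EFinP; apply: measurable_fun_natr.
  by apply: measurable_fun_natb; exact: measurable_fun_ler.
rewrite EFinM ger0_norm//; congr (_ * _).
rewrite -uniform_prob_itvNyc// -unifX//.
transitivity (\int[distribution P X]_x (\1_(`]-oo, c w]%classic) x)%:E).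
  by apply: eq_integral => x _; rewrite indicE mem_setE.
by rewrite integral_indic// setIT.
Qed.

End independence.

(** * The basic independence model *)

Section leave_one_out_independence.
Context (d : measure_display) (T : measurableType d) (R : realType).
Variables (P : probability T R) (n : nat) (H : 'I_n -> {RV P >-> bool}).
Variables xi U : 'I_n -> {RV P >-> R}.
Hypothesis BI : basic_independence H xi U.
Local Open Scope ereal_scope.

Lemma g_sigma_preimage_mem (d' : measure_display) (T' : measurableType d')
    (m : nat) (f : 'I_m -> T -> T') i (B : set T') :
  measurable B -> g_sigma_preimage f (f i @^-1` B).
Proof.
move=> mB; apply: sub_sigma_algebra; rewrite -bigcup_seq/=.
by exists i; [rewrite /= mem_index_enum|exists B => //; rewrite setTI].
Qed.

Lemma g_sigma_preimage_measurable (d' : measure_display)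
    (T' : measurableType d') (m : nat) (f : 'I_m -> T -> T') :
  (forall i, measurable_fun setT (f i)) ->
  g_sigma_preimage f `<=` measurable.
Proof.
move=> mf; apply: smallest_sub; first exact: sigma_algebra_measurable.
rewrite -bigcup_seq/=; apply: bigcup_sub => i _ _ [B mB <-].
exact: mf.
Qed.

(** A pi-system generating the information in all of [(H, xi)], index [i] included, and in the [U j]
    with [j != i]. *)
Definition other_events (i : 'I_n) : set_system T :=
  [set A | exists C (B : 'I_n -> set R),
    [/\ g_sigma_preimage (fun j w => (H j w, xi j w)) C,
        forall j, measurable (B j) &
        A = C `&` \bigcap_(j in [set` [set~ i]%SET]) (U j @^-1` B j)]].

Lemma other_events_measurable i : other_events i `<=` measurable.
Proof.
move=> _ [C [B [mC mB ->]]]; apply: measurableI.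
  apply: g_sigma_preimage_measurable mC => j.
  exact: measurable_fun_pair.
apply: fin_bigcap_measurable => // j _; exact: measurable_funPTI.
Qed.

Lemma other_eventsT i : other_events i setT.
Proof.
exists setT, (fun=> setT); split => //.
  exact: (@measurableT _ (g_sigma_algebraType _)).
by rewrite bigcapT ?setTI.
Qed.

Lemma other_eventsI i : setI_closed (other_events i).
Proof.
move=> _ _ [C [B [mC mB ->]]] [C' [B' [mC' mB' ->]]].
exists (C `&` C'), (fun j => B j `&` B' j); split.
- exact: (@measurableI _ (g_sigma_algebraType _)).
- by move=> j; exact: measurableI.
- by rewrite setIACA -bigcapI.
Qed.

(** By the pi-system criterion only sets [C]&[D] matter, where [C] concerns [(H, xi)] and [D] the
    other uniforms. Independence of [U] from [(H, xi)] splits off [C], and mutual independence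
    splits [U i] from [D]. *)
Lemma independent_other_events i (A : set R) (B : set T) :
  measurable A -> <<s other_events i >> B ->
  P (U i @^-1` A `&` B) = P (U i @^-1` A) * P B.
Proof.
move=> mA; move: B; apply: independent_g_sigma_algebra.
- exact: measurable_funPTI.
- exact: other_events_measurable.
- exact: other_eventsI.
- exact: other_eventsT.
move=> _ [C [B [mC mB ->]]].
set D := \bigcap_(j in _) _.
(* Placing [A] at coordinate [i] writes both [D] and its intersection with the event of [U i] as
   intersections over index sets, as mutual independence requires. *)
pose B' j := if j == i then A else B j.
have mB' j : measurable (B' j) by rewrite /B'; case: ifP.
have UD (J : {set 'I_n}) : g_sigma_preimage (fun j w => U j w)
    (\bigcap_(j in [set` J]) (U j @^-1` B' j)).
  apply: (@fin_bigcap_measurable _ (g_sigma_algebraType _)) => // j _.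
  exact: (@g_sigma_preimage_mem _ _ _ (fun j w => U j w)).
have DE : D = \bigcap_(j in [set` [set~ i]%SET]) (U j @^-1` B' j).
  by apply: eq_bigcapr => j /=; rewrite !inE /B' => /negbTE ->.
have ADE : U i @^-1` A `&` D =
    \bigcap_(j in [set` [set: 'I_n]%SET]) (U j @^-1` B' j).
  rewrite DE; apply/seteqP; split => [w [Aw Dw] j _|w Dw].
    have [->|ji] := eqVneq j i; first by rewrite /B' eqxx.
    by apply: Dw; rewrite /= !inE.
  split; last by move=> j _; apply: Dw; rewrite /= inE.
  by have := Dw i; rewrite /B' eqxx; apply; rewrite /= inE.
have PAD : P (U i @^-1` A `&` D) = P (U i @^-1` A) * P D.
  rewrite ADE DE !(U_independent BI)// (bigD1 i)/=; last by rewrite inE.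
  rewrite {1}/B' eqxx; congr (_ * _); apply: eq_bigl => j.
  by rewrite !inE.
have indep := U_independent_Hxi BI.
(* [C] is split off twice: from the event with [U i] here, and from [D] alone afterwards. *)
rewrite [C `&` D]setIC setIA (indep (U i @^-1` A `&` D))//; last by rewrite ADE.
by rewrite (indep D) ?PAD ?muleA// DE.
Qed.

Lemma measurable_other_hypothesis i j :
  measurable_fun setT (H j : g_sigma_algebraType (other_events i) -> bool) /\
  measurable_fun setT (xi j : g_sigma_algebraType (other_events i) -> R).
Proof.
have sub C : g_sigma_preimage (fun j w => (H j w, xi j w)) C ->
    <<s other_events i >> C.
  move=> mC; apply: sub_sigma_algebra; exists C, (fun=> setT); split => //.
  by rewrite bigcapT ?setIT.
split=> _ B mB; rewrite setTI; apply: sub.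
- rewrite (_ : _ @^-1` _ = (fun w => (H j w, xi j w)) @^-1` (B `*` setT)).
    exact: (@g_sigma_preimage_mem _ _ _ (fun j w => (H j w, xi j w)) j _
      (measurableX mB measurableT)).
  by apply/seteqP; split=> w //= [].
- rewrite (_ : _ @^-1` _ = (fun w => (H j w, xi j w)) @^-1` (setT `*` B)).
    exact: (@g_sigma_preimage_mem _ _ _ (fun j w => (H j w, xi j w)) j _
      (measurableX measurableT mB)).
  by apply/seteqP; split=> w //= [].
Qed.

Lemma measurable_other_uniform i j : j != i ->
  measurable_fun setT (U j : g_sigma_algebraType (other_events i) -> R).
Proof.
move=> ji _ B mB; rewrite setTI; apply: sub_sigma_algebra.
exists setT, (fun l => if l == j then B else setT); split.
- exact: (@measurableT _ (g_sigma_algebraType _)).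
- by move=> l; case: ifP.
rewrite setTI; apply/seteqP; split=> [w Bw l _ /=|w /(_ j)].
  by case: eqP => // ->.
by rewrite /= !inE eqxx; apply.
Qed.

(** Coordinate [i] is constant after the reset, so [U i] does not enter. Everything computed
    measurably from the reset p-values is thus independent of [U i]. *)
Lemma measurable_reset_pvalue i j :
  measurable_fun setT (fun w : g_sigma_algebraType (other_events i) =>
    reset_pvalue i (pvalue H xi U w) j).
Proof.
rewrite /reset_pvalue; case: eqP => [_//|/eqP ji].
have [mH mxi] := measurable_other_hypothesis i j.
have mHr : measurable_fun setT
    (fun w : g_sigma_algebraType (other_events i) => (H j w)%:R : R).
  exact/measurable_fun_natr/measurable_fun_natb.
apply: measurable_funD; apply: measurable_funM => //.
- exact: measurable_funB.
- exact: measurable_other_uniform.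
Qed.

Lemma measurable_fun_other_events i (f : T -> R) :
  measurable_fun setT (f : g_sigma_algebraType (other_events i) -> R) ->
  measurable_fun setT f.
Proof.
move=> mf _ B mB; have := mf measurableT B mB.
apply: smallest_sub; first exact: sigma_algebra_measurable.
exact: other_events_measurable.
Qed.

Lemma measurable_pvalue j : measurable_fun setT (fun w => pvalue H xi U w j).
Proof.
have mHr : measurable_fun setT (fun w => (H j w)%:R : R).
  exact/measurable_fun_natr/measurable_fun_natb.
by apply: measurable_funD; apply: measurable_funM => //; exact: measurable_funB.
Qed.

End leave_one_out_independence.

(** * Expectations of nonnegative random variables *)

Section expectation_nonneg.
Context (d : measure_display) (T : measurableType d) (R : realType).
Variable P : probability T R.
Local Open Scope ereal_scope.

Lemma ge0_expectation_sum (I : Type) (s : seq I) (f : I -> T -> R) :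
  (forall i, measurable_fun setT (f i)) -> (forall i w, 0 <= f i w)%R ->
  'E_P[fun w => (\sum_(i <- s) f i w)%R] = \sum_(i <- s) 'E_P[f i].
Proof.
move=> mf f0; rewrite unlock.
under eq_integral do rewrite -sumEFin.
rewrite ge0_integral_sum//.
- by move=> i; exact/measurable_EFinP.
- by move=> i w _; rewrite lee_fin.
Qed.

Lemma ge0_expectationZl (f : T -> R) (a : R) :
  measurable_fun setT f -> (forall w, 0 <= f w)%R -> (0 <= a)%R ->
  'E_P[fun w => (a * f w)%R] = a%:E * 'E_P[f].
Proof.
move=> mf f0 a0; rewrite unlock.
under eq_integral do rewrite EFinM.
rewrite ge0_integralZl_EFin//; last exact/measurable_EFinP.
by move=> w _; rewrite lee_fin.
Qed.

Lemma ge0_le_expectation (f g : T -> R) :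
  measurable_fun setT f -> measurable_fun setT g ->
  (forall w, 0 <= f w)%R -> (forall w, f w <= g w)%R -> 'E_P[f] <= 'E_P[g].
Proof.
move=> mf mg f0 fg; apply: expectation_le => //.
- by move=> w; exact: le_trans (fg w).
- exact: aeW.
Qed.

End expectation_nonneg.

(** * Convex combinations of estimators *)

Lemma convex_comb_gt0 (R : realFieldType) (k : nat) (beta x : 'I_k -> R) :
  (forall j, 0 < beta j) -> \sum_(j < k) beta j = 1 -> (forall j, 0 < x j) ->
  0 < \sum_(j < k) beta j * x j.
Proof.
case: k => [|k] in beta x *; move=> b0 b1 x0.
  (* An empty family of weights would sum to 0 instead of 1. *)
  by move: b1; rewrite big_ord0 => /eqP; rewrite eq_sym oner_eq0.
rewrite big_ord_recl ltr_pwDl ?mulr_gt0//.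
by apply: sumr_ge0 => j _; rewrite mulr_ge0 ?ltW.
Qed.

Section estimators.
Context (R : realType) (T : Type) (n : nat) (lambda : R) (p : T -> 'I_n -> R).

(* A strictly positive estimator may be unconstrained on functions that are not
   realised as [late_ecdf (p w)]; there it is redefined to be [1]. *)
Lemma estimator_gt0 (N : T -> R) : is_estimator lambda p N ->
  exists g : g_sigma_algebraType (@cylinders R {t : R | lambda <= t <= 1}) -> R,
    [/\ measurable_fun setT g, forall F, 0 < g F &
        forall w, N w = g (late_ecdf (p w))].
Proof.
move=> [N0 [g [mg Ng]]].
exists (fun F => if 0 < g F then g F else 1); split.
- by apply: measurable_fun_ifT => //; exact: measurable_fun_ltr.
- by move=> F; case: ifP.
- by move=> w; rewrite -Ng N0.
Qed.

Lemma is_estimator_convex_comb (k : nat) (beta : 'I_k -> R)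
    (N : 'I_k -> T -> R) :
  (forall j, 0 < beta j) -> \sum_(j < k) beta j = 1 ->
  (forall j, is_estimator lambda p (N j)) ->
  is_estimator lambda p (fun w => \sum_(j < k) beta j * N j w).
Proof.
move=> b0 b1 /(_ _)/estimator_gt0 est.
have [g hg] := choice est.
split=> [w|].
  by apply: convex_comb_gt0 => // j; have [_ ? ->] := hg j.
exists (fun F => \sum_(j < k) beta j * g j F); split.
  by apply: measurable_sum => j; apply: measurable_funM => //; case: (hg j).
by move=> w; apply: eq_bigr => j _; have [_ _ ->] := hg j.
Qed.

End estimators.

(** Jensen's inequality for the inverse: the tangent bound at the weighted mean is averaged with the
    weights. *)
Lemma convex_comb_inv (R : realFieldType) (k : nat) (beta x : 'I_k -> R) :
  (forall j, 0 < beta j) -> \sum_(j < k) beta j = 1 -> (forall j, 0 < x j) ->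
  (\sum_(j < k) beta j * x j)^-1 <= \sum_(j < k) beta j / x j.
Proof.
move=> b0 b1 x0; set s := \sum_(j < k) _.
have s0 : 0 < s by exact: convex_comb_gt0.
(* tangent line of [x^-1] at [s]: [x^-1 >= (2 - x / s) / s] *)
have tangent y : 0 < y -> s^-1 * (2 - y / s) <= y^-1.
  move=> y0; rewrite -subr_ge0.
  have -> : y^-1 - s^-1 * (2 - y / s) = y^-1 * (1 - y / s) ^+ 2.
    by field; rewrite !gt_eqF.
  by rewrite mulr_ge0 ?invr_ge0 ?sqr_ge0 ?ltW.
(* The weighted mean of the [x j] is [s], so the averaged bracket equals 2 - 1. *)
have -> : s^-1 = \sum_(j < k) beta j * (s^-1 * (2 - x j / s)).
  under eq_bigr do rewrite mulrCA mulrBr mulrA.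
  rewrite -mulr_sumr sumrB -!mulr_suml b1 -/s mul1r divff ?gt_eqF//.
  by rewrite (_ : 2 - 1 = 1) ?mulr1//; ring.
by apply: ler_sum => j _; rewrite ler_pM2l ?tangent.
Qed.

(** * The bound on the false discovery rate *)

Section false_discovery_rate.
Context (d : measure_display) (T : measurableType d) (R : realType).
Variables (P : probability T R) (n : nat) (H : 'I_n -> {RV P >-> bool}).
Variables (xi U : 'I_n -> {RV P >-> R}) (alpha lambda : R).
Hypothesis BI : basic_independence H xi U.
Hypothesis alpha_gt0 : 0 < alpha.
Hypothesis alpha_lt_lambda : alpha < lambda.
Hypothesis lambda_lt1 : lambda < 1.
Variable g : g_sigma_algebraType (@cylinders R {t : R | lambda <= t <= 1}) -> R.
Hypothesis mg : measurable_fun setT g.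
Hypothesis g0 : forall F, 0 < g F.

Let p := pvalue H xi U.
Let N (w : T) : R := g (late_ecdf (p w)).
Let crit (w : T) (m : nat) : R := Num.min (m%:R / N w * alpha) lambda.

Let lambda_gt0 : 0 < lambda. Proof. exact: lt_trans alpha_lt_lambda. Qed.

Definition reset_crit i (w : T) (m : nat) : R :=
  Num.min (m%:R / g (late_ecdf (reset_pvalue i (p w))) * alpha) lambda.

Definition reset_rejections i (w : T) : nat :=
  su_rejections (reset_pvalue i (p w)) (reset_crit i w).

Let crit_homo w : {homo crit w : a b / (a <= b)%N >-> a <= b}.
Proof.
move=> a b ab; rewrite /crit le_min2//.
by rewrite ler_wpM2r ?ler_wpM2r ?invr_ge0 ?ler_nat// ltW// g0.
Qed.

Let crit_ge0 w m : 0 <= crit w m.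
Proof.
by rewrite /crit le_min (ltW lambda_gt0) andbT !mulr_ge0 ?invr_ge0// ltW// g0.
Qed.

Let reset_crit_bounds i w m : 0 <= reset_crit i w m <= 1.
Proof.
rewrite /reset_crit le_min (ltW lambda_gt0) ge_min (ltW lambda_lt1) orbT !andbT.
by rewrite !mulr_ge0 ?invr_ge0// ltW// g0.
Qed.

Let reset_rejections_gt0 i w : (0 < reset_rejections i w)%N.
Proof.
by apply: su_rejections_reset_gt0; case/andP: (reset_crit_bounds i w 1).
Qed.

Let pvalue_true i w : ~~ H i w -> p w i = U i w.
Proof.
by rewrite /p /pvalue => /negbTE ->; rewrite subr0 mul1r mul0r addr0.
Qed.

(** The left side is nonzero only if [i] is a true hypothesis with p-value below the threshold. Then
    the reset changes neither the critical values nor the number of rejections, and both sides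
    coincide; elsewhere the right side is nonnegative. *)
Lemma false_rejection_le i w :
  (((p w i <= crit w (su_rejections (p w) (crit w)))%R && ~~ H i w)%:R /
     (maxn (su_rejections (p w) (crit w)) 1)%:R : R) <=
  (~~ H i w)%:R / (reset_rejections i w)%:R *
    (U i w <= reset_crit i w (reset_rejections i w))%R%:R.
Proof.
case: (boolP (H i w)) => [_|Hi]; first by rewrite andbF !mul0r.
rewrite andbT; have [pi|_] := boolP (p w i <= _); last first.
  by rewrite mul0r !mulr_ge0 ?invr_ge0.
have pl : p w i <= lambda by rewrite (le_trans pi)// /crit ge_min lexx orbT.
have critE : reset_crit i w = crit w.
  by apply/funext => m; rewrite /reset_crit /crit /N ecdf_reset// ltW.
have RE : reset_rejections i w = su_rejections (p w) (crit w).
  rewrite /reset_rejections critE.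
  exact: su_rejections_reset (crit_homo w) (crit_ge0 w 0) pi.
rewrite RE critE -pvalue_true// pi mulr1.
have R0 : (0 < su_rejections (p w) (crit w))%N.
  exact: su_rejections_gt0 (crit_ge0 w 0) (crit_homo w (leq0n 1)) pi.
by rewrite (maxn_idPl R0).
Qed.

Let S i := other_events H xi U i.

Let mreset_N i : measurable_fun setT (fun w : g_sigma_algebraType (S i) =>
  (g (late_ecdf (reset_pvalue i (p w))))^-1).
Proof.
apply: measurable_fun_inv_gt0 => //; apply: measurable_estimator mg _ => j.
exact: measurable_reset_pvalue.
Qed.

Let mreset_crit i m : measurable_fun setT
  (fun w : g_sigma_algebraType (S i) => reset_crit i w m).
Proof.
apply: measurable_minr => //; apply: measurable_funM => //.
exact: measurable_funM.
Qed.

Let mtrue i : measurable_fun setT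
  (fun w : g_sigma_algebraType (S i) => (~~ H i w)%:R : R).
Proof.
apply/measurable_fun_natr/measurable_fun_natb/measurable_neg.
by have [] := measurable_other_hypothesis H xi U i i.
Qed.

Let expectation_le_reset i (Y c : T -> R) :
  measurable_fun setT (Y : g_sigma_algebraType (S i) -> R) ->
  measurable_fun setT (c : g_sigma_algebraType (S i) -> R) ->
  (forall w, 0 <= Y w) -> (forall w, 0 <= c w <= 1) ->
  ('E_P[fun w => (Y w * (U i w <= c w)%R%:R)%R] =
   'E_P[fun w => (Y w * c w)%R])%E.
Proof.
move=> mY mc Y0 c01; apply: (expectation_uniform_le (S := S i)) => //.
- exact: U_uniform BI i.
- apply: smallest_sub; first exact: sigma_algebra_measurable.
  exact: other_events_measurable.
- by move=> A B; exact: independent_other_events.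
Qed.

Let mp j : measurable_fun setT (fun w => p w j).
Proof. exact: measurable_pvalue. Qed.

Let N_gt0 w : 0 < N w. Proof. exact: g0. Qed.

Let mN_inv : measurable_fun setT (fun w => (N w)^-1).
Proof. by apply: measurable_fun_inv_gt0 => //; exact: measurable_estimator. Qed.

Let mcrit m : measurable_fun setT (crit^~ m).
Proof.
apply: measurable_minr => //; apply: measurable_funM => //.
exact: measurable_funM.
Qed.

Let mU_le i (c : T -> R) : measurable_fun setT c ->
  measurable_fun setT (fun w => (U i w <= c w)%R%:R : R).
Proof.
move=> mc; apply/measurable_fun_natr/measurable_fun_natb.
exact: measurable_fun_ler.
Qed.

Let mp_le i (c : T -> R) : measurable_fun setT c ->
  measurable_fun setT (fun w => ((p w i <= c w)%R && ~~ H i w)%:R : R).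
Proof.
move=> mc; apply/measurable_fun_natr/measurable_fun_natb/measurable_and.
  exact: measurable_fun_ler.
exact: measurable_neg.
Qed.

Let mfalse i : measurable_fun setT (fun w =>
  ((p w i <= crit w (su_rejections (p w) (crit w)))%R && ~~ H i w)%:R /
     (maxn (su_rejections (p w) (crit w)) 1)%:R : R).
Proof.
apply: measurable_funM; first by apply: mp_le; exact: measurable_su_threshold.
apply: measurable_fun_inv_gt0 => [w|]; first by rewrite ltr0n leq_max orbT.
apply/measurable_fun_natr/measurable_fun_maxn => //.
exact: measurable_su_rejections.
Qed.

Let mtrue_over_N i : measurable_fun setT (fun w =>
  ((p w i <= lambda)%R && ~~ H i w)%:R / N w : R).
Proof.
by apply: measurable_funM; first exact: mp_le.
Qed.

Lemma expectation_false_rejection_le i :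
  ('E_P[fun w => (((p w i <= crit w (su_rejections (p w) (crit w)))%R
      && ~~ H i w)%:R / (maxn (su_rejections (p w) (crit w)) 1)%:R)%R] <=
   (alpha / lambda)%:E *
   'E_P[fun w => (((p w i <= lambda)%R && ~~ H i w)%:R / N w)%R])%E.
Proof.
pose Y w : R := (~~ H i w)%:R / (reset_rejections i w)%:R.
pose c w := reset_crit i w (reset_rejections i w).
pose Z w : R := (~~ H i w)%:R / g (late_ecdf (reset_pvalue i (p w))).
have Y0 w : 0 <= Y w by rewrite mulr_ge0.
have Z0 w : 0 <= Z w by rewrite mulr_ge0// invr_ge0 ltW.
have mc : measurable_fun setT (c : g_sigma_algebraType (S i) -> R).
  apply: measurable_su_threshold => // j; exact: measurable_reset_pvalue.
have mY : measurable_fun setT (Y : g_sigma_algebraType (S i) -> R).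
  apply: measurable_funM => //; apply: measurable_fun_inv_gt0 => [w|].
    by rewrite ltr0n.
  apply: measurable_fun_natr; apply: measurable_su_rejections => // j.
  exact: measurable_reset_pvalue.
have mZ : measurable_fun setT (Z : g_sigma_algebraType (S i) -> R).
  exact: measurable_funM.
have c01 w : 0 <= c w <= 1 by exact: reset_crit_bounds.
have mYT := measurable_fun_other_events mY.
have mcT := measurable_fun_other_events mc.
have mZT := measurable_fun_other_events mZ.
apply: (@le_trans _ _ 'E_P[fun w => (Y w * (U i w <= c w)%R%:R)%R])%E.
  apply: ge0_le_expectation => //.
  - by apply: measurable_funM => //; exact: mU_le.
  - exact: false_rejection_le.
(* [U i] is integrated out: its indicator becomes the threshold [c]. *)
rewrite expectation_le_reset//.
(* Bounding the minimum in [c] by its first argument cancels the number of rejections and leaves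
   [Z w * alpha]. The factor [lambda] is split off to be read as the probability that [U i] is at
   most [lambda]. *)
apply: (@le_trans _ _ 'E_P[fun w => (alpha / lambda * (Z w * lambda))%R])%E.
  apply: ge0_le_expectation.
  - exact: measurable_funM.
  - by apply: measurable_funM => //; exact: measurable_funM.
  - by move=> w /=; rewrite mulr_ge0//; case/andP: (c01 w).
  move=> w; have -> : alpha / lambda * (Z w * lambda) = Z w * alpha.
    by field; rewrite gt_eqF.
  have -> : Z w * alpha = Y w * ((reset_rejections i w)%:R /
      g (late_ecdf (reset_pvalue i (p w))) * alpha).
    rewrite /Z /Y; field.
    by rewrite !gt_eqF// ltr0n.
  by rewrite ler_wpM2l// /c /reset_crit ge_min lexx.
rewrite ge0_expectationZl; last 3 first.
- exact: measurable_funM.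
- by move=> w /=; rewrite mulr_ge0// ltW.
- by rewrite divr_ge0// ltW.
(* The same identity is used backwards with a constant threshold, bringing the indicator of
   [U i w <= lambda] back in. *)
rewrite -(expectation_le_reset (i := i) (c := cst lambda))//; last first.
  by move=> w; rewrite !ltW.
rewrite le_eqVlt; apply/orP; left; apply/eqP; congr (_ * 'E_P[_])%E.
(* For a true hypothesis with p-value at most [lambda] the estimator is unchanged by the reset; in
   all other cases both sides vanish. *)
apply/funext => w; rewrite /Z.
case: (boolP (H i w)) => [_|Hi]; first by rewrite andbF !mul0r.
rewrite andbT -pvalue_true//; have [pl|_] := boolP (p w i <= lambda).
  by rewrite /N ecdf_reset ?(ltW lambda_gt0)// mulr1.
by rewrite mulr0 mul0r.
Qed.

Lemma FDR_le_expectation :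
  (FDR P (fun w i => H i w) p crit <= (alpha / lambda)%:E *
   'E_P[fun w => ((true_null_count (H ^~ w) (p w) lambda)%:R / N w)%R])%E.
Proof.
rewrite /FDR /su_false_rejections /true_null_count.
under eq_fun do rewrite natr_sum mulr_suml.
under [in leRHS]eq_fun do rewrite natr_sum mulr_suml.
rewrite !ge0_expectation_sum//; last first.
  by move=> i w; rewrite mulr_ge0// invr_ge0 ltW.
rewrite ge0_sume_distrr.
  by apply: lee_sum => i _; exact: expectation_false_rejection_le.
move=> i _; apply: expectation_ge0 => w.
by rewrite mulr_ge0// invr_ge0 ltW.
Qed.

End false_discovery_rate.

Theorem corollary5 (R : realType) (d : measure_display) (T : measurableType d)
    (P : probability T R) (n : nat) (H : 'I_n -> {RV P >-> bool})
    (xi U : 'I_n -> {RV P >-> R}) (alpha lambda : R)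
    (k : nat) (beta : 'I_k -> R) (nhat : 'I_k -> T -> R) :
  (1 <= n)%N ->
  basic_independence H xi U ->
  0 < alpha -> alpha < lambda -> lambda < 1 ->
  (forall j, 0 < beta j) ->
  \sum_(j < k) beta j = 1 ->
  (forall j, is_estimator lambda (pvalue H xi U) (nhat j)) ->
  let h := fun w i => H i w in
  let p := pvalue H xi U in
  let V := fun w t => true_null_count (h w) (p w) t in
  (forall j, ('E_P[fun w => ((V w lambda)%:R / nhat j w)%R] <= lambda%:E)%E) ->
  let n0 := fun w => \sum_(j < k) beta j * nhat j w in
  let crit := fun w (i : nat) => Num.min (i%:R / n0 w * alpha) lambda in
  ('E_P[fun w => ((V w lambda)%:R / n0 w)%R] <= lambda%:E)%E /\
  (FDR P h p crit <= alpha%:E)%E.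
Proof.
move=> n1 BI alpha0 alpha_lambda lambda1 beta0 beta1 est h p V EV n0 crit.
have lambda0 : 0 < lambda := lt_trans alpha0 alpha_lambda.
have nhat0 j w : 0 < nhat j w by case: (est j).
have mnhat j : measurable_fun setT (nhat j).
  have [g [mg _ Ng]] := estimator_gt0 (est j).
  rewrite (_ : nhat j = fun w => g (late_ecdf (p w))); last exact/funext.
  by apply: measurable_estimator => // i; exact: measurable_pvalue.
have mV : measurable_fun setT (fun w => (V w lambda)%:R : R).
  apply: measurable_fun_natr; apply: measurable_true_null_count => // i.
  exact: measurable_pvalue.
have n0_est : is_estimator lambda p n0 by exact: is_estimator_convex_comb.
(* Positivity of [g] everywhere matters: it is evaluated at reset p-values, whose empirical
   distribution function need not be realised by any [p w]. *)
have [g [mg g0 n0E]] := estimator_gt0 n0_est.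
have mn0 : measurable_fun setT n0.
  rewrite (_ : n0 = fun w => g (late_ecdf (p w))); last exact/funext.
  by apply: measurable_estimator => // i; exact: measurable_pvalue.
have n0_gt0 w : 0 < n0 w by case: n0_est.
have Vn0 : ('E_P[fun w => ((V w lambda)%:R / n0 w)%R] <= lambda%:E)%E.
  have mVn j : measurable_fun setT (fun w => (V w lambda)%:R / nhat j w).
    by apply: measurable_funM => //; exact: measurable_fun_inv_gt0.
  have Vn_ge0 j w : 0 <= (V w lambda)%:R / nhat j w.
    by rewrite mulr_ge0// invr_ge0 ltW.
  (* Convexity of the inverse bounds the ratio pointwise by the weighted sum of the individual
     ratios. *)
  apply: (@le_trans _ _ 'E_P[fun w =>
      (\sum_(j < k) beta j * ((V w lambda)%:R / nhat j w))%R])%E.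
    apply: ge0_le_expectation.
    - by apply: measurable_funM => //; exact: measurable_fun_inv_gt0.
    - by apply: measurable_sum => j; exact: measurable_funM.
    - by move=> w; rewrite mulr_ge0// invr_ge0 ltW.
    move=> w; under eq_bigr do rewrite mulrCA.
    by rewrite -mulr_sumr ler_wpM2l// convex_comb_inv.
  rewrite ge0_expectation_sum; last 2 first.
  - by move=> j; exact: measurable_funM.
  - by move=> j w; rewrite mulr_ge0// ltW.
  apply: (@le_trans _ _ (\sum_(j < k) (beta j * lambda)%:E)%E).
    apply: lee_sum => j _; rewrite ge0_expectationZl// ?(ltW (beta0 j))//.
    by rewrite EFinM lee_wpmul2l// lee_fin ltW.
  by rewrite sumEFin -mulr_suml beta1 mul1r.
split=> //.
have n0E' : n0 = fun w => g (late_ecdf (p w)) by exact/funext.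
rewrite /crit n0E'; apply: le_trans (FDR_le_expectation BI _ _ _ mg g0) _ => //.
rewrite (_ : alpha%:E = ((alpha / lambda)%:E * lambda%:E)%E); last first.
  by rewrite -EFinM divfK ?gt_eqF.
apply: lee_wpmul2l; first by rewrite lee_fin divr_ge0 ?ltW.
by move: Vn0; rewrite n0E'.
Qed.
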